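(* Let $\mathbf{A}, \mathbf{B}$ be random closed sets in $\mathbb{R}^d$ with $\mathbf{A}, \mathbf{B} \subset \operatorname{cl} \mathcal{D}$, with $\partial \mathbf{A} \neq \emptyset$ and $\partial \mathbf{B} \neq \emptyset$ almost surely, and suppose that $E[b_{\mathbf{A}}(x)]$ and $E[b_{\mathbf{B}}(x)]$ exist (i.e. $E|b_{\mathbf{A}}(x)|<\infty$ and $E|b_{\mathbf{B}}(x)|<\infty$) for some $x \in \operatorname{cl}\mathcal{D}$, so that the expected sets $E[\mathbf{A}]$, $E[\mathbf{B}]$ and expected boundaries $E[\partial\mathbf{A}]$, $E[\partial\mathbf{B}]$ are well defined. Then: (1) $E[\mathbf{A}]$ is a closed set. (2) If $\mathbf{A} = A$ almost surely for some deterministic closed set $A$, then $E[\mathbf{A}] = A$ and $E[\partial \mathbf{A}] = \partial A$. (3) If $\partial \mathbf{A} = B$ almost surely for some deterministic set $B$, then $E[\partial \mathbf{A}] \supset B$. (4) $\partial E[\mathbf{A}] \subset E[\partial \mathbf{A}]$. (5) If $E[b_{\mathbf{A}}(x)] \geq E[b_{\mathbf{B}}(x)]$ for all $x \in \mathbb{R}^d$, then $E[\mathbf{A}] \subset E[\mathbf{B}]$. (6) If $\mathbf{A} \subset \mathbf{B}$ almost surely, then $E[\mathbf{A}] \subset E[\mathbf{B}]$.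
   Context: Let $(\Omega, \mathscr{A}, \mathbf{P})$ be a probability space, $\mathcal{F}$ the family of closed subsets of $\mathbb{R}^d$, and $\mathcal{D} \subset \mathbb{R}^d$ a fixed bounded set (the domain). A random closed set is a map $\mathbf{A}:\Omega\to\mathcal{F}$ such that $\{\omega : \mathbf{A}(\omega)\cap K \neq \emptyset\} \in \mathscr{A}$ for every compact $K\subset\mathbb{R}^d$. For a nonempty set $A\subset\mathbb{R}^d$ let $d_A(x)=\inf_{y\in A}|x-y|$ (Euclidean norm). For a set $A\subset\mathbb{R}^d$ with $\partial A\ne\emptyset$, the oriented distance function (ODF) is $b_A(x) = d_A(x) - d_{A^c}(x)$, $x\in\mathbb{R}^d$; it is $1$-Lipschitz in $x$. For a random closed set $\mathbf{A}$ with $\partial\mathbf{A}\neq\emptyset$ a.s. and $E|b_{\mathbf{A}}(x_0)|<\infty$ for some $x_0$ (equivalently for all $x_0\in\mathbb{R}^d$), the expected set and expected boundary are $$E[\mathbf{A}] = \{x\in\mathbb{R}^d : E[b_{\mathbf{A}}(x)] \le 0\}, \qquad E[\partial\mathbf{A}] = \{x\in\mathbb{R}^d : E[b_{\mathbf{A}}(x)] = 0\}.$$ Here $E[\partial \mathbf{A}]$ is a single piece of notation determined by $\mathbf{A}$ (it is not the expected set of the random closed set $\partial\mathbf{A}$). *)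

(* Defs.v *)
From HB Require Import structures.
From mathcomp Require Import all_boot all_order all_algebra.
From mathcomp Require Import all_classical all_reals all_analysis.
Import Order.TTheory GRing.Theory Num.Theory.
Import numFieldNormedType.Exports.

Set Implicit Arguments.
Unset Strict Implicit.
Unset Printing Implicit Defensive.

Local Open Scope classical_set_scope.
Local Open Scope ring_scope.

(* Points of R^n are row vectors. The norm [`|x|] that the library puts on
   'rV[R]_n is the sup norm, so the Euclidean norm is defined here; both induce
   the product topology, hence the library's closed, compact, bounded, closure
   and interior are the usual ones. *)
Definition enorm (R : realType) (n : nat) (x : 'rV[R]_n) : R :=
  Num.sqrt (\sum_(i < n) x ord0 i ^+ 2).

Definition boundary (T : topologicalType) (A : set T) : set T :=
  closure A `\` interior A.

(* Meaningful for nonempty A only: [inf set0] is 0. *)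
Definition distance_function (R : realType) (n : nat) (A : set 'rV[R]_n)
    (x : 'rV[R]_n) : R :=
  inf [set enorm (x - y) | y in A].

(* Meaningful when A has a nonempty boundary, so that A and its complement are
   both nonempty. *)
Definition odf (R : realType) (n : nat) (A : set 'rV[R]_n) (x : 'rV[R]_n) : R :=
  distance_function A x - distance_function (~` A) x.

Definition random_closed_set (R : realType) (n : nat) (d : measure_display)
    (T : measurableType d) (A : T -> set 'rV[R]_n) : Prop :=
  (forall w, closed (A w)) /\
  (forall K : set 'rV[R]_n, compact K ->
     measurable [set w | A w `&` K !=set0]).

Definition expected_set (R : realType) (n : nat) (d : measure_display)
    (T : measurableType d) (P : probability T R) (A : T -> set 'rV[R]_n) :
    set 'rV[R]_n :=
  [set x | ('E_P[fun w => odf (A w) x] <= 0)%E].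

Definition expected_boundary (R : realType) (n : nat) (d : measure_display)
    (T : measurableType d) (P : probability T R) (A : T -> set 'rV[R]_n) :
    set 'rV[R]_n :=
  [set x | ('E_P[fun w => odf (A w) x] = 0)%E].

(* Main.v *)
(* When the boundary of A is nonempty, both A and its complement are nonempty,
   and the oriented distance b_A is 2-Lipschitz, as the difference of two
   1-Lipschitz distances (the constant 1 is not needed). Integrating, finiteness
   of E|b_A(x0)| propagates to every x, and x |-> E[b_A(x)] is continuous. This
   makes its sublevel set {<= 0} closed and puts the boundary of that set inside
   the zero level. The other claims come from monotonicity of the expectation
   together with two facts for closed A: {b_A <= 0} is A, and {b_A = 0} is the
   boundary of A. The expectation is monotone and additive because b_A(x) is a
   random variable. *)
Require Import Defs.
From HB Require Import structures.
From mathcomp Require Import all_boot all_order all_algebra.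
From mathcomp Require Import all_classical all_reals all_analysis.
From mathcomp Require Import measurable_realfun ring lra.
Import Order.TTheory GRing.Theory Num.Theory.
Import numFieldNormedType.Exports.

Set Implicit Arguments.
Unset Strict Implicit.
Unset Printing Implicit Defensive.

Local Open Scope classical_set_scope.
Local Open Scope ring_scope.

(** * Euclidean norm and its comparison with the sup norm *)

Section enorm.
Context {R : realType} {n : nat}.
Implicit Types x y : 'rV[R]_n.

Lemma enorm_ge0 x : 0 <= enorm x.
Proof. exact: sqrtr_ge0. Qed.

Lemma enorm_sqr x : enorm x ^+ 2 = \sum_(i < n) x ord0 i ^+ 2.
Proof. by rewrite sqr_sqrtr// sumr_ge0// => i _; rewrite sqr_ge0. Qed.

Lemma enorm0 : enorm (0 : 'rV[R]_n) = 0.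
Proof. by rewrite /enorm big1 ?sqrtr0// => i _; rewrite mxE expr0n. Qed.

Lemma enormN x : enorm (- x) = enorm x.
Proof. by congr Num.sqrt; apply: eq_bigr => i _; rewrite mxE sqrrN. Qed.

Lemma enormBC x y : enorm (x - y) = enorm (y - x).
Proof. by rewrite -enormN opprB. Qed.

(* Cauchy-Schwarz from the nonnegativity of
   [enorm (enorm y *: x - enorm x *: y) ^+ 2]. *)
Lemma dot_le_enorm x y :
  \sum_(i < n) x ord0 i * y ord0 i <= enorm x * enorm y.
Proof.
set a := enorm x; set b := enorm y; set s := \sum_(i < n) _.
have a0 : 0 <= a by exact: enorm_ge0.
have b0 : 0 <= b by exact: enorm_ge0.
have E : enorm (b *: x - a *: y) ^+ 2 = 2 * (a * b) * (a * b - s).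
  transitivity (b ^+ 2 * (\sum_(i < n) x ord0 i ^+ 2) - 2 * (a * b) * s +
      a ^+ 2 * (\sum_(i < n) y ord0 i ^+ 2)); last first.
    by rewrite -!enorm_sqr -/a -/b; ring.
  rewrite [LHS]enorm_sqr !mulr_sumr -sumrB -big_split/=.
  by apply: eq_bigr => i _; rewrite !mxE; ring.
(* The identity [E] yields the bound only after cancelling [a * b]; if this product is zero, one of
   the two vectors is zero and so is [s]. *)
have [ab0|ab0] := eqVneq (a * b) 0; last first.
  have ab : 0 < a * b by rewrite lt_def ab0 mulr_ge0.
  rewrite -subr_ge0 -(pmulr_rge0 _ (mulr_gt0 (@ltr0Sn R 1) ab)) -E.
  exact: sqr_ge0.
have z0 (z : 'rV[R]_n) : enorm z = 0 -> forall i, z ord0 i = 0.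
  move=> z0 i; apply/eqP; rewrite -sqrf_eq0 eq_le sqr_ge0 andbT.
  have -> : 0 = enorm z ^+ 2 by rewrite z0 expr0n.
  rewrite enorm_sqr.
  by rewrite (bigD1 i)//= lerDl sumr_ge0// => j _; rewrite sqr_ge0.
rewrite ab0 /s big1// => i _.
move/eqP : ab0; rewrite mulf_eq0 => /orP[]/eqP/z0 ->.
  by rewrite mul0r.
by rewrite mulr0.
Qed.

Lemma enormD x y : enorm (x + y) <= enorm x + enorm y.
Proof.
rewrite -ler_sqr ?nnegrE ?addr_ge0 ?enorm_ge0// enorm_sqr.
have -> : \sum_(i < n) (x + y) ord0 i ^+ 2 =
    enorm x ^+ 2 + enorm y ^+ 2 + 2 * \sum_(i < n) x ord0 i * y ord0 i.
  rewrite !enorm_sqr mulr_sumr -!big_split/=.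
  by apply: eq_bigr => i _; rewrite !mxE; ring.
have := dot_le_enorm x y; lra.
Qed.

Lemma enorm_triangle z x y : enorm (x - y) <= enorm (x - z) + enorm (z - y).
Proof. by rewrite -[in leLHS](subrKA z) enormD. Qed.

Lemma norm_coord x i : `|x ord0 i| <= `|x|.
Proof.
rewrite {2}/Num.norm/= mx_normrE.
exact: (le_bigmax_cond _ (fun ij : 'I_1 * 'I_n => `|x ij.1 ij.2|) (j := (ord0, i))).
Qed.

(** The sharp constant is the square root of [n]; the cruder [n] suffices for continuity and reduces
    the claim to [n <= n ^ 2]. *)
Lemma enorm_le_norm x : enorm x <= n%:R * `|x|.
Proof.
rewrite -ler_sqr ?nnegrE ?mulr_ge0 ?enorm_ge0// enorm_sqr.
apply: (@le_trans _ _ (\sum_(i < n) `|x| ^+ 2)).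
  apply: ler_sum => i _; rewrite -real_normK ?num_real//.
  by rewrite ler_sqr ?nnegrE ?norm_coord.
rewrite sumr_const card_ord -[leLHS]mulr_natl exprMn ler_wpM2r ?sqr_ge0//.
by rewrite -natrX ler_nat; case: (n) => // k; rewrite leq_pmulr.
Qed.

Lemma coord_le_enorm x i : `|x ord0 i| <= enorm x.
Proof.
rewrite -ler_sqr ?nnegrE ?enorm_ge0// real_normK ?num_real// enorm_sqr.
by rewrite (bigD1 i)//= lerDl sumr_ge0// => j _; rewrite sqr_ge0.
Qed.

Lemma norm_le_enorm x : `|x| <= enorm x.
Proof.
rewrite {1}/Num.norm/= mx_normrE; apply: bigmax_le => [|[i j] _].
  exact: enorm_ge0.
by rewrite ord1 coord_le_enorm.
Qed.

(** The one-sided bound gives the two-sided one by exchanging [x] and [y]; the factor [n] then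
    converts it to the sup norm that carries the topology. *)
Lemma enorm_lipschitz_continuous (k : R) (f : 'rV[R]_n -> R) :
  0 <= k -> (forall x y, f x <= f y + k * enorm (x - y)) -> continuous f.
Proof.
move=> k0 fk x; apply/(@cvgrPdist_lt _ _ _ _ (nbhs_filter x)) => e e0.
(* Adding 1 keeps the divisor positive when [k] or [n] is 0. *)
have kn : 0 < k * n%:R + 1 by rewrite ltr_pwDr// mulr_ge0.
apply: (proj2 (@nbhs_normP R 'rV[R]_n x _)).
exists (e / (k * n%:R + 1)); first exact: divr_gt0.
move=> y /= xy; apply: (@le_lt_trans _ _ ((k * n%:R + 1) * `|x - y|)).
  have := ler_wpM2l k0 (enorm_le_norm (x - y)).
  have := fk x y; have := fk y x; rewrite (enormBC y x).
  have := normr_ge0 (x - y); rewrite mulrDl mul1r mulrA ler_norml; lra.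
by rewrite mulrC -ltr_pdivlMr.
Qed.

Lemma continuous_enormB x : continuous (fun y => enorm (x - y)).
Proof.
apply: (@enorm_lipschitz_continuous 1) => // y z.
by rewrite mul1r (enormBC y z) enorm_triangle.
Qed.

Lemma nbhs_enorm x e : 0 < e -> nbhs x [set y | enorm (x - y) < e].
Proof.
move=> e0; have := @continuous_enormB x x.
move/cvgr_lt; apply; by rewrite subrr enorm0.
Qed.

End enorm.

(** * Distance functions and the oriented distance of a fixed set *)

Section distance.
Context {R : realType} {n : nat}.
Implicit Types (A B : set 'rV[R]_n) (x y : 'rV[R]_n).

Lemma distance_has_lbound A x : has_lbound [set enorm (x - y) | y in A].
Proof. by exists 0 => _ [y _ <-]; exact: enorm_ge0. Qed.

Lemma distance_ge0 A x : 0 <= distance_function A x.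
Proof.
have [->|A0] := eqVneq A set0; first by rewrite /distance_function image_set0 inf0.
apply: lb_le_inf; first by apply/image_nonempty/set0P.
by move=> _ [y _ <-]; exact: enorm_ge0.
Qed.

Lemma distance_le A x y : A y -> distance_function A x <= enorm (x - y).
Proof.
move=> Ay; apply: ge_inf; first exact: distance_has_lbound.
by exists y.
Qed.

(** With strict inequalities the infimum need not be attained. This turns sublevel events of the
    distance into events of hitting an open ball. *)
Lemma distance_lt A x (r : R) : A !=set0 ->
  distance_function A x < r <-> exists2 y, A y & enorm (x - y) < r.
Proof.
move=> A0; split=> [/inf_lt|[y Ay]].
  case; first exact/image_nonempty.
  by move=> _ [y Ay <-] yr; exists y.
exact/le_lt_trans/distance_le.
Qed.

Lemma distance_lipschitz A x y : A !=set0 ->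
  distance_function A x <= distance_function A y + enorm (x - y).
Proof.
move=> A0; rewrite -lerBlDr; apply: lb_le_inf; first exact/image_nonempty.
move=> _ [z Az <-]; rewrite lerBlDr [leRHS]addrC.
exact: le_trans (distance_le _ Az) (enorm_triangle y x z).
Qed.

Lemma distance_subset A B x : A `<=` B -> A !=set0 ->
  distance_function B x <= distance_function A x.
Proof.
move=> AB A0; apply: lb_le_inf; first exact/image_nonempty.
by move=> _ [z Az <-]; apply/distance_le/AB.
Qed.

Lemma distance_eq0 A x : A !=set0 -> distance_function A x = 0 <-> closure A x.
Proof.
move=> A0; split=> [dx0 U|Ax].
  move=> /(proj1 (@nbhs_normP R 'rV[R]_n x _)) [e /= e0 eU].
  have : distance_function A x < e by rewrite dx0.
  move/(distance_lt _ _ A0) => [y Ay xy]; exists y; split => //.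
  by apply: eU => /=; exact: le_lt_trans (norm_le_enorm _) xy.
apply/eqP; rewrite eq_le distance_ge0 andbT; apply/ler_addgt0Pr => e e0.
have [y [Ay xy]] := Ax _ (nbhs_enorm x e0).
by rewrite add0r (le_trans (distance_le x Ay))// ltW.
Qed.

Lemma distance_mem A x : A x -> distance_function A x = 0.
Proof.
move=> Ax; apply/distance_eq0; first by exists x.
exact: subset_closure.
Qed.

Lemma boundaryE A : boundary A = closure A `&` closure (~` A).
Proof. by rewrite /boundary setDE closure_setC. Qed.

Lemma boundary_nonempty A : boundary A !=set0 -> A !=set0 /\ ~` A !=set0.
Proof.
rewrite boundaryE => -[x [Ax nAx]].
have [y [Ay _]] := Ax _ filterT; have [z [Az _]] := nAx _ filterT.
by split; [exists y|exists z].
Qed.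

Lemma odf_lipschitz A x y : boundary A !=set0 ->
  odf A x <= odf A y + 2 * enorm (x - y).
Proof.
move=> /boundary_nonempty[A0 A1]; rewrite /odf.
have := distance_lipschitz x y A0; have := distance_lipschitz y x A1.
rewrite (enormBC y x); lra.
Qed.

(** Enlarging the set lowers the distance to it and, by shrinking the complement, raises the
    distance to the complement. The boundary hypotheses keep the smaller set of each pair nonempty,
    away from the convention [inf set0 = 0]. *)
Lemma odf_le A B x : A `<=` B -> boundary A !=set0 -> boundary B !=set0 ->
  odf B x <= odf A x.
Proof.
move=> AB /boundary_nonempty[A0 _] /boundary_nonempty[_ B1].
by rewrite /odf lerB// distance_subset//; exact: subsetC.
Qed.

Lemma odf_boundary A x : boundary A x -> odf A x = 0.
Proof.
move=> bx; have [A0 A1] : A !=set0 /\ ~` A !=set0.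
  by apply: boundary_nonempty; exists x.
move: bx; rewrite boundaryE /odf => -[Ax nAx].
by rewrite (proj2 (distance_eq0 _ A0) Ax) (proj2 (distance_eq0 _ A1) nAx) subrr.
Qed.

(** Off [A] the distance to the complement vanishes, so a nonpositive value forces the distance to
    [A] to be 0, and closedness puts [x] in [A]. *)
Lemma odf_le0 A x : closed A -> boundary A !=set0 -> odf A x <= 0 <-> A x.
Proof.
move=> cA /boundary_nonempty[A0 A1]; split => [|Ax].
  apply: contraPP => nAx; rewrite /odf (@distance_mem (~` A))// subr0 => dx.
  apply: nAx; apply: cA; apply/(distance_eq0 _ A0).
  by apply/eqP; rewrite eq_le dx distance_ge0.
by rewrite /odf (distance_mem Ax) sub0r oppr_le0 distance_ge0.
Qed.

Lemma odf_eq0 A x : closed A -> boundary A !=set0 -> odf A x = 0 <-> boundary A x.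
Proof.
move=> cA bA; split; last exact: odf_boundary.
move=> /[dup] bx0 /eqP; rewrite eq_le => /andP[/(odf_le0 _ cA bA) Ax _].
have [A0 A1] := boundary_nonempty bA.
rewrite boundaryE; split; first exact: subset_closure.
apply/(distance_eq0 _ A1)/eqP.
by move: bx0; rewrite /odf (distance_mem Ax) sub0r => /eqP; rewrite oppr_eq0.
Qed.

End distance.

(** * Measurability of the oriented distance at a point *)

Section measurability.
Context {R : realType} {n : nat} {d : measure_display} {T : measurableType d}.
Implicit Types (A C : T -> set 'rV[R]_n) (x : 'rV[R]_n).

(** The open half-lines below [r] generate the Borel sets, and their preimages are essentially the
    hitting events of open balls. *)
Lemma measurable_distance C x :
  (forall r, measurable [set w | exists2 y, C w y & enorm (x - y) < r]) ->
  measurable_fun setT (fun w => distance_function (C w) x).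
Proof.
move=> mC mT; apply: (measurability _ (RGenInftyO.measurableE R)) => //.
move=> _ [_ [r ->] <-]; rewrite setTI.
(* A set is nonempty iff it meets some ball of integer radius around [x]. *)
have mC0 : measurable [set w | C w !=set0].
  rewrite [X in measurable X](_ : _ =
      \bigcup_k [set w | exists2 y, C w y & enorm (x - y) < k%:R]).
    exact: bigcup_measurable.
  apply/seteqP; split=> [w [y Cy]|w [k _ [y Cy _]]]; last by exists y.
  exists (Num.truncn (enorm (x - y))).+1 => //; exists y => //.
  exact: truncnS_gt.
(* The second piece accounts for outcomes where [C w] is empty: the distance is then 0 by
   convention, hence below [r] exactly when [r] is positive. *)
rewrite [X in measurable X](_ : _ =
    [set w | exists2 y, C w y & enorm (x - y) < r] `|`
    (~` [set w | C w !=set0] `&` [set _ | 0 < r])).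
  apply: measurableU => //; apply: measurableI; first exact: measurableC.
  have [r0|r0] := ltP 0 r.
    by rewrite [X in measurable X](_ : _ = setT)//; apply/seteqP; split.
  by rewrite [X in measurable X](_ : _ = set0)//; apply/seteqP; split.
apply/seteqP; split=> w /=; rewrite in_itv/=.
  move=> dr; have [Cw|Cw] := pselect (C w !=set0).
    by left; exact/distance_lt.
  right; split => //; suff <- : distance_function (C w) x = 0 by [].
  have -> : C w = set0 by apply/eqP; apply: contra_notT Cw => /set0P.
  by rewrite /distance_function image_set0 inf0.
case=> [[y Cy xy]|[Cw r0]]; first by apply/distance_lt; [exists y|exists y].
have -> : C w = set0 by apply/eqP; apply: contra_notT Cw => /set0P.
by rewrite /distance_function image_set0 inf0.
Qed.

Lemma compact_enorm_ball x (r : R) : compact [set y : 'rV[R]_n | enorm (x - y) <= r].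
Proof.
apply: bounded_closed_compact.
  exists (`|x| + r); split; first exact: num_real.
  move=> M rM y /= xy; rewrite (le_trans _ (ltW rM))//.
  rewrite -[y in leLHS](subKr x) (le_trans (ler_normB _ _))// lerD2l.
  exact: le_trans (norm_le_enorm _) xy.
have := proj1 (continuous_closedP _) (@continuous_enormB _ _ x) [set z | z <= r].
by apply; exact: closed_le.
Qed.

(** An open ball is a countable union of compact concentric balls, and hitting a compact set is
    measurable by definition of a random closed set. *)
Lemma measurable_hit_enorm_ball A x (r : R) : random_closed_set A ->
  measurable [set w | exists2 y, A w y & enorm (x - y) < r].
Proof.
move=> [_ mA].
rewrite [X in measurable X](_ : _ =
    \bigcup_k [set w | A w `&` [set y | enorm (x - y) <= r - k.+1%:R^-1] !=set0]).
  by apply: bigcup_measurable => k _; apply: mA; exact: compact_enorm_ball.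
apply/seteqP; split=> [w [y Ay xy]|w [k _ [y [Ay /= xy]]]].
  have [k xyk] := ltr_add_invr xy.
  by exists k => //; exists y; split=> //=; rewrite lerBrDr ltW.
by exists y => //; apply: le_lt_trans xy _; rewrite ltrBlDr ltrDl invr_gt0.
Qed.

Lemma rat_dense_rV (U : set 'rV[R]_n) y : open U -> U y ->
  exists q : 'rV[rat]_n, U (map_mx ratr q).
Proof.
move=> oU Uy; have : nbhs y U by exact: open_nbhs_nbhs.
move=> /(proj1 (@nbhs_normP R 'rV[R]_n y _)) [e /= e0 eU].
(* Each coordinate is approximated within [e / 2], so that the non-strict bound on the maximum still
   gives a norm strictly below [e]. *)
have e20 : 0 < e / 2 by rewrite divr_gt0.
have q_ i : {q : rat | ratr q \in `](y ord0 i - e / 2), (y ord0 i + e / 2)[}.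
  by apply/cid/rat_in_itvoo; rewrite ltrD2l gtrN.
exists (\row_i projT1 (q_ i)); apply: eU => /=.
apply: (@le_lt_trans _ _ (e / 2)); last by rewrite gtr_pMr// invf_lt1 ?ltr1n.
rewrite {1}/Num.norm/= mx_normrE; apply: bigmax_le => [|[i j] _]; first exact: ltW.
rewrite !mxE/= ord1; case: (q_ j) => q /=; rewrite in_itv/= => /andP[? ?].
rewrite ler_norml; lra.
Qed.

(* The complement of [A w] is open, so it meets an open ball iff the ball
   contains a rational point outside [A w]. *)
Lemma measurable_hit_setC_enorm_ball A x (r : R) : random_closed_set A ->
  measurable [set w | exists2 y, (~` A w) y & enorm (x - y) < r].
Proof.
move=> [cA mA].
rewrite [X in measurable X](_ : _ =
    \bigcup_(q in [set q : 'rV[rat]_n | enorm (x - map_mx ratr q) < r])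
      ~` [set w | A w `&` [set map_mx ratr q] !=set0]).
  rewrite bigcup_mkcond; apply: countable_bigcupT_measurable => [|q].
    exact: countableP.
  case: ifP => // _; apply: measurableC; apply: mA; exact: compact_set1.
apply/seteqP; split=> [w [y Ay xy]|w [q /= xq Aq]].
  have [|q [Aq xq]] := @rat_dense_rV
      (~` A w `&` [set z | enorm (x - z) < r]) y _ (conj Ay xy).
    apply: openI; first exact/closed_openC.
    have := proj1 (continuousP _) (@continuous_enormB _ _ x) [set z | z < r].
    by apply; exact: open_lt.
  by exists q => //= -[z [Az zq]]; apply: Aq; rewrite -zq.
by exists (map_mx ratr q) => // Aq'; apply: Aq; exists (map_mx ratr q).
Qed.

Lemma measurable_odf A x : random_closed_set A ->
  measurable_fun setT (fun w => odf (A w) x).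
Proof.
move=> rA; apply: measurable_funB; apply: measurable_distance => r.
  exact: measurable_hit_enorm_ball.
exact: measurable_hit_setC_enorm_ball.
Qed.

End measurability.

(** * Expectation under almost sure relations *)

(** The difference [Y \- X] agrees almost everywhere with its absolute value, whose integral is
    nonnegative. *)
Lemma ae_expectation_le {R : realType} {d : measure_display}
    {T : measurableType d} (P : probability T R) (X Y : T -> R) :
  X \in Lfun P 1 -> Y \in Lfun P 1 -> {ae P, forall w, X w <= Y w} ->
  ('E_P[X] <= 'E_P[Y])%E.
Proof.
move=> LX LY XY; rewrite -sube_ge0 ?expectation_fin_num ?orbT//.
rewrite -expectationB// unlock.
have /Lfun1_integrable/integrableP[mYX _] : Y \- X \in Lfun P 1.
  by rewrite rpredB ?lee1n.
rewrite (ae_eq_integral (fun w => `|(Y \- X) w|%:E))//.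
- by apply: integral_ge0 => w _; rewrite lee_fin.
- by apply/measurable_EFinP/measurableT_comp => //; exact/measurable_EFinP.
- by apply: filterS XY => w XYw _; rewrite ger0_norm// subr_ge0.
Qed.

Lemma ae_expectation_cst {R : realType} {d : measure_display}
    {T : measurableType d} (P : probability T R) (X : T -> R) (r : R) :
  X \in Lfun P 1 -> {ae P, forall w, X w = r} -> ('E_P[X] = r%:E)%E.
Proof.
move=> LX Xr; rewrite -(expectation_cst P r); apply/eqP.
have Lr : cst r \in Lfun P 1 by exact: Lfun_cst.
rewrite eq_le !ae_expectation_le//.
  by apply: filterS Xr => w ->.
by apply: filterS Xr => w ->.
Qed.

(** * The expected oriented distance and its level sets *)

Section expectation_odf.
Context {R : realType} {n : nat} {d : measure_display} {T : measurableType d}.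
Context (P : probability T R) (A : T -> set 'rV[R]_n).
Context (rcsA : random_closed_set A).
Context (bdryA : {ae P, forall w, boundary (A w) !=set0}).

Lemma Lfun_odf x0 : ('E_P[fun w => `|odf (A w) x0|%R] < +oo)%E ->
  forall x, (fun w => odf (A w) x) \in Lfun P 1.
Proof.
rewrite unlock => fin0 x; apply/Lfun1_integrable/integrableP; split.
  exact/measurable_EFinP/measurable_odf.
have mabs y : measurable_fun setT (fun w => `|odf (A w) y|%:E).
  by apply/measurable_EFinP/measurableT_comp => //; exact: measurable_odf.
pose c := 2 * enorm (x - x0).
have c0 : 0 <= c by rewrite mulr_ge0 ?enorm_ge0.
(* The Lipschitz bound, used in both directions, dominates the absolute value at [x] by the one at
   [x0] plus [c], almost surely; [c] is integrable because [P] has mass 1. *)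
apply: (@le_lt_trans _ _ (\int[P]_w (`|odf (A w) x0|%:E + c%:E))%E).
  apply: ae_ge0_le_integral => //=.
  - by move=> w _; rewrite adde_ge0 ?lee_fin.
  - exact: emeasurable_funD.
  apply: filterS bdryA => w bw _; rewrite -EFinD lee_fin.
  have := odf_lipschitz x x0 bw; have := odf_lipschitz x0 x bw.
  have := ler_norm (odf (A w) x0); have := ler_norm (- odf (A w) x0).
  rewrite (enormBC x0 x) normrN -/c ler_norml; lra.
rewrite ge0_integralD//.
apply: lte_add_pinfty => //; have := expectation_cst P c.
by rewrite unlock /cst => ->; rewrite ltry.
Qed.

Context (LA : forall x, (fun w => odf (A w) x) \in Lfun P 1).

Lemma expectation_odf_lipschitz x y :
  ('E_P[fun w => odf (A w) x] <=
   'E_P[fun w => odf (A w) y] + (2 * enorm (x - y))%:E)%E.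
Proof.
rewrite -(expectation_cst P) -expectationD ?Lfun_cst//.
apply: ae_expectation_le => //; first by rewrite rpredD ?lee1n ?Lfun_cst.
by apply: filterS bdryA => w bw /=; exact: odf_lipschitz.
Qed.

(** Integrability makes the expectation finite, so [m] loses no information and continuity can be
    argued with real values. *)
Let m x := fine 'E_P[fun w => odf (A w) x]%E.

Let mE x : ('E_P[fun w => odf (A w) x] = (m x)%:E)%E.
Proof. by rewrite fineK// expectation_fin_num. Qed.

Let continuous_m : continuous m.
Proof.
apply: (@enorm_lipschitz_continuous _ _ 2) => // x y.
by rewrite -lee_fin EFinD -!mE expectation_odf_lipschitz.
Qed.

Let expected_setE : expected_set P A = m @^-1` [set z | z <= 0].
Proof.
by apply/seteqP; split => x; rewrite /expected_set /= mE lee_fin.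
Qed.

Lemma closed_expected_set : closed (expected_set P A).
Proof.
rewrite expected_setE.
have := proj1 (continuous_closedP _) continuous_m [set z | z <= 0].
by apply; exact: closed_le.
Qed.

Lemma boundary_expected_set : boundary (expected_set P A) `<=` expected_boundary P A.
Proof.
rewrite /boundary -(proj1 (closure_id _) closed_expected_set) => x [].
rewrite expected_setE /expected_boundary/= mE => mx0 nint.
(* If [m x] were negative, the open set where [m] is negative would be a neighbourhood of [x] inside
   the expected set, making [x] interior. *)
congr EFin; apply/eqP; rewrite eq_le mx0/= leNgt; apply/negP => mx_lt0.
apply: nint; have : nbhs x (m @^-1` [set z | z < 0]).
  apply: open_nbhs_nbhs; split=> //.
  have := proj1 (continuousP _) continuous_m [set z | z < 0].
  by apply; exact: open_lt.
by apply: filterS => y /= /ltW.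
Qed.

Lemma expected_set_cst A0 : closed A0 -> {ae P, forall w, A w = A0} ->
  expected_set P A = A0 /\ expected_boundary P A = boundary A0.
Proof.
move=> cA0 AA0.
(* Total mass 1 makes the almost-everywhere filter proper, so some outcome satisfies both almost
   sure hypotheses; it shows that [A0] has a nonempty boundary. *)
have PF : ProperFilter (almost_everywhere P).
  apply: ae_properfilter_algebraOfSetsType.
  by suff : (0 < P setT)%E by []; rewrite probability_setT lte01.
have [w [bw Aw]] := @filter_ex _ _ PF _ (filterI bdryA AA0).
rewrite Aw in bw.
have E x : ('E_P[fun w => odf (A w) x] = (odf A0 x)%:E)%E.
  by apply: ae_expectation_cst => //; apply: filterS AA0 => v ->.
split; apply/seteqP; split => x; rewrite /expected_set /expected_boundary/= E.
- by rewrite lee_fin => /(odf_le0 _ cA0 bw).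
- by move=> Ax; rewrite lee_fin; apply/(odf_le0 _ cA0 bw).
- by move=> [/(odf_eq0 _ cA0 bw)].
- by move=> /(odf_eq0 _ cA0 bw) ->.
Qed.

Lemma expected_boundary_supset B0 : {ae P, forall w, boundary (A w) = B0} ->
  B0 `<=` expected_boundary P A.
Proof.
move=> AB0 x Bx; apply: ae_expectation_cst => //.
by apply: filterS AB0 => w Aw; apply: odf_boundary; rewrite Aw.
Qed.

End expectation_odf.
Theorem theorem3p1 (R : realType) (n : nat) (d : measure_display)
    (T : measurableType d) (P : probability T R)
    (D : set 'rV[R]_n) (A B : T -> set 'rV[R]_n)
    (bndD : bounded_set D)
    (rcsA : random_closed_set A) (rcsB : random_closed_set B)
    (subA : {ae P, forall w, A w `<=` closure D})
    (subB : {ae P, forall w, B w `<=` closure D})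
    (bdryA : {ae P, forall w, boundary (A w) !=set0})
    (bdryB : {ae P, forall w, boundary (B w) !=set0})
    (intAB : exists x : 'rV[R]_n, [/\ closure D x,
       ('E_P[fun w => (`|odf (A w) x|)%R] < +oo)%E &
       ('E_P[fun w => (`|odf (B w) x|)%R] < +oo)%E]) :
  (* 1 *) closed (expected_set P A) /\
  (* 2 *) (forall A0 : set 'rV[R]_n, closed A0 ->
             {ae P, forall w, A w = A0} ->
             expected_set P A = A0 /\ expected_boundary P A = boundary A0) /\
  (* 3 *) (forall B0 : set 'rV[R]_n,
             {ae P, forall w, boundary (A w) = B0} ->
             B0 `<=` expected_boundary P A) /\
  (* 4 *) boundary (expected_set P A) `<=` expected_boundary P A /\
  (* 5 *) ((forall x : 'rV[R]_n,
             ('E_P[fun w => odf (B w) x] <= 'E_P[fun w => odf (A w) x])%E) ->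
             expected_set P A `<=` expected_set P B) /\
  (* 6 *) ({ae P, forall w, A w `<=` B w} ->
             expected_set P A `<=` expected_set P B).
Proof.
move: intAB => [x0 [_ /(Lfun_odf rcsA bdryA) LA /(Lfun_odf rcsB bdryB) LB]].
have mono : (forall x : 'rV[R]_n,
    ('E_P[fun w => odf (B w) x] <= 'E_P[fun w => odf (A w) x])%E) ->
    expected_set P A `<=` expected_set P B.
  by move=> BA x /=; exact/le_trans/BA.
split; first exact: closed_expected_set.
split; first by move=> A0; exact: expected_set_cst.
split; first by move=> B0; exact: expected_boundary_supset.
split; first exact: boundary_expected_set.
(* Almost sure inclusion reverses the order of the oriented distances, hence of their expectations,
   so [mono] applies. *)
split=> // AB; apply: mono => x; apply: ae_expectation_le => //.
by apply: filterS (filterI AB (filterI bdryA bdryB)) => w [? [? ?]]; exact: odf_le.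
Qed.
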